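(* Let $\mathbf{C}^{\rm P}$ be symmetric, i.e. $\mathbf{C}^{\rm P}=\mathbf{C}^{\rm M}$. (1) If $\mathbf{r}^{\rm P}(t)$ is normal, then the empty set is a real-critical set of $\mathbf{P}(s,t)$; that is, every point of $\mathbf{S}\cap\mathbb{R}^3$ is reachable by $\mathbf{P}$. (2) If $\mathbf{r}^{\rm P}(t)$ is not normal, and $(0,b,c)$ is its critical point, then $\{(0,b,c)\}$ is a real-critical set of $\mathbf{P}(s,t)$.
   Context: Setting: $p(t),q(t)\in\mathbb{R}(t)$ are rational functions with real coefficients, $p$ is not identically zero and $q$ is not constant. $\mathbf{r}^{\rm P}(t)=(0,p(t),q(t))$ is assumed proper, i.e. injective up to finitely many parameter values (birational onto its image curve). The profile curve $\mathbf{C}^{\rm P}$ is the complex algebraic curve in the $(y,z)$-plane $\{x=0\}\subset\mathbb{C}^3$ parametrized by $\mathbf{r}^{\rm P}$ (the Zariski closure of the image). The mirror curve $\mathbf{C}^{\rm M}$ is the curve parametrized in the same sense by $\mathbf{r}^{\rm M}(t)=(0,-p(t),q(t))$. The surface of revolution $\mathbf{S}\subset\mathbb{C}^3$ generated by rotating $\mathbf{C}^{\rm P}$ around the $z$-axis is the Zariski closure of the image of $$\mathbf{P}(s,t)=\left(\frac{2s}{1+s^2}\,p(t),\frac{1-s^2}{1+s^2}\,p(t),q(t)\right).$$ Parameters take complex values wherever the expressions are defined; a point is reachable by a parametrization if it is its value at some such complex parameter(s). Recalled fact: if $f(y,z)=A(y^2,z)+yB(y^2,z)$ is the defining polynomial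 of $\mathbf{C}^{\rm P}$, then $\mathbf{S}$ is the zero set of $F=A(x^2+y^2,z)$ if $B=0$ (equivalently, if $\mathbf{C}^{\rm P}$ is symmetric), and of $F=A^2(x^2+y^2,z)-(x^2+y^2)B^2(x^2+y^2,z)$ otherwise. $\mathbf{r}^{\rm P}$ is normal if every point of $\mathbf{C}^{\rm P}$ is reachable by $\mathbf{r}^{\rm P}(t)$, $t\in\mathbb{C}$. A proper curve parametrization misses at most one point of its curve; if $\mathbf{r}^{\rm P}$ is not normal, the unique missed point is called its critical point, and it equals $\lim_{t\to\infty}\mathbf{r}^{\rm P}(t)$. A real-critical set of $\mathbf{P}$ is a subset of $\mathbf{S}$ of dimension smaller than 2 containing every point of $\mathbf{S}\cap\mathbb{R}^3$ that is not reachable by $\mathbf{P}$. *)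

(* Defs.v *)
From mathcomp Require Import all_boot all_order all_algebra.
From mathcomp Require Import fraction complex mpoly.
From mathcomp Require Import boolp classical_sets reals.

Set Implicit Arguments.
Unset Strict Implicit.
Unset Printing Implicit Defensive.

Import GRing.Theory.
Local Open Scope ring_scope.
Local Open Scope classical_set_scope.

Definition point3 (A : Type) (x y z : A) : 'rV[A]_3 :=
  \row_(i < 3) nth x [:: x; y; z] i.

Section Zariski.
Variables (K : fieldType) (n : nat).
Implicit Types X Y Z : set 'rV[K]_n.

Definition zeros (I : set {mpoly K[n]}) : set 'rV[K]_n :=
  [set v : 'rV[K]_n | forall f, I f -> f.@[v ord0] = 0].

Definition vanishing (X : set 'rV[K]_n) : set {mpoly K[n]} :=
  [set f : {mpoly K[n]} | forall v : 'rV[K]_n, X v -> f.@[v ord0] = 0].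

Definition zariski_closed X := exists I, X = zeros I.

Definition zariski_closure X := zeros (vanishing X).

Definition zariski_irreducible X :=
  X !=set0 /\
  forall Y Z, zariski_closed Y -> zariski_closed Z ->
    X `<=` Y `|` Z -> X `<=` Y \/ X `<=` Z.

(* The dimension of X is the Krull dimension of its Zariski closure, so it is
   smaller than d when there is no chain Z_0 < ... < Z_d; in particular the
   empty set has dimension smaller than 0. *)
Definition dim_lt X (d : nat) :=
  ~ exists Z : nat -> set 'rV[K]_n,
      (forall i, (i <= d)%N ->
         [/\ zariski_closed (Z i), zariski_irreducible (Z i)
           & Z i `<=` zariski_closure X]) /\
      (forall i, (i < d)%N -> Z i `<` Z i.+1).

End Zariski.

Section Revolution.
Variable R : realType.
Local Notation C := R[i].
Local Notation Rt := {fraction {poly R}}.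

(* f is defined at t, with value w.  The denominator b is not required to be
   coprime to a: f is defined at t as soon as some representation a / b has
   b(t) <> 0, which is then the case of the reduced one. *)
Definition ratval (f : Rt) (t w : C) :=
  exists a b : {poly R},
    [/\ f = tofrac a / tofrac b,
        (map_poly (real_complex R) b).[t] != 0
      & w = (map_poly (real_complex R) a).[t]
            / (map_poly (real_complex R) b).[t]].

Definition curve_val (r : 'rV[Rt]_3) (t : C) (v : 'rV[C]_3) :=
  forall i, ratval (r ord0 i) t (v ord0 i).

Definition curve_reach (r : 'rV[Rt]_3) : set 'rV[C]_3 :=
  [set v : 'rV[C]_3 | exists t, curve_val r t v].

Definition curve (r : 'rV[Rt]_3) : set 'rV[C]_3 :=
  zariski_closure (curve_reach r).

Definition proper_param (r : 'rV[Rt]_3) :=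
  exists E : seq C, forall t1 t2 v, t1 \notin E -> t2 \notin E ->
    curve_val r t1 v -> curve_val r t2 v -> t1 = t2.

Definition normal_param (r : 'rV[Rt]_3) := curve r `<=` curve_reach r.

(* That a missed point is unique, and equal to the limit of r at infinity, is
   a theorem about rational parametrizations; it is not assumed here. *)
Definition critical_point (r : 'rV[Rt]_3) (v : 'rV[C]_3) :=
  curve r v /\ ~ curve_reach r v.

Definition profile (p q : Rt) : 'rV[Rt]_3 := point3 0 p q.

Definition mirror (p q : Rt) : 'rV[Rt]_3 := point3 0 (- p) q.

Definition symmetric_profile (p q : Rt) :=
  curve (profile p q) = curve (mirror p q).

Definition surface_val (p q : Rt) (s t : C) (v : 'rV[C]_3) :=
  1 + s ^+ 2 != 0 /\
  exists y z : C, [/\ ratval p t y, ratval q t z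
    & v = point3 (2 * s / (1 + s ^+ 2) * y)
                 ((1 - s ^+ 2) / (1 + s ^+ 2) * y) z].

Definition surface_reach (p q : Rt) : set 'rV[C]_3 :=
  [set v : 'rV[C]_3 | exists s t, surface_val p q s t v].

Definition surface (p q : Rt) : set 'rV[C]_3 :=
  zariski_closure (surface_reach p q).

Definition real_points : set 'rV[C]_3 :=
  range (fun u : 'rV[R]_3 => map_mx (real_complex R) u).

Definition real_critical_set (p q : Rt) (X : set 'rV[C]_3) :=
  [/\ X `<=` surface p q, dim_lt X 2
    & surface p q `&` real_points `\` surface_reach p q `<=` X].

End Revolution.

Arguments real_points R : clear implicits.

(* Main.v *)
Require Import Defs.
From mathcomp Require Import all_boot all_order all_algebra.
From mathcomp Require Import generic_quotient fraction complex mpoly.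
From mathcomp Require Import boolp classical_sets reals.
From mathcomp Require Import ring.

Set Implicit Arguments.
Unset Strict Implicit.
Unset Printing Implicit Defensive.

Import GRing.Theory Num.Theory.
Local Open Scope ring_scope.
Local Open Scope classical_set_scope.

(** A real point (x, y, z) of the surface lies on the circle of squared radius
    x^2 + y^2 at height z.  The theorem says that it can be missed only if it
    is itself a point of the profile curve that the profile parametrization
    misses, and that there is at most one such point.

    The circle meets the profile plane x = 0 in (0, r, z) and (0, -r, z), where
    r^2 = x^2 + y^2, and symmetry puts both of these points on the profile curve
    ([surface_slice]).  Rotating (0, r, z) by the rational parametrization of
    the circle reaches every point of the circle except (0, -r, z)
    ([circle_param]).  Hence, if x <> 0, the point (x, y, z) is reached as soon
    as one of (0, r, z), (0, -r, z) is reached by the profile.  If both were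
    missed they would coincide, so that r = 0, which for a real point forces
    x = y = 0.  If x = 0, the point is on the profile curve, and the parameter
    s = 0 reaches it whenever the profile does ([missed_surface_point]).

    That a plane rational curve misses at most one point
    ([critical_point_unique]) is elimination theory.  With y = a(t) / b(t) and
    z = c(t) / d(t) in lowest terms, the resultant in t of a - y b and c - z d
    is a polynomial in y and z that vanishes on the reached points, hence on
    the whole curve.  It is taken as a Sylvester determinant of fixed formal
    degrees, so its vanishing at a point means that the two specialized
    polynomials either have a common root, which is a parameter reaching the
    point, or both have a zero leading coefficient, that is, a common root at
    infinity.  The latter condition determines y and z.  In other words, the image
    of the projective line is closed, and the curve can lose only the value of
    the parametrization at infinity. *)

(** * Closures and dimension of points *)

Section ZariskiFacts.
Variables (K : fieldType) (n : nat).
Implicit Types X Y : set 'rV[K]_n.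

Lemma sub_zariski_closure X : X `<=` zariski_closure X.
Proof. by move=> v Xv f; apply. Qed.

Lemma zariski_closureS X Y :
  X `<=` Y -> zariski_closure X `<=` zariski_closure Y.
Proof. by move=> XY v clXv f Yf; apply: clXv => w /XY; apply: Yf. Qed.

Lemma zariski_closure_point (v : 'rV[K]_n) : zariski_closure [set v] = [set v].
Proof.
apply/seteqP; split; last exact: sub_zariski_closure.
move=> w clw; apply/rowP => i; apply/eqP; rewrite -subr_eq0.
have /clw : vanishing [set v] ('X_i - (v ord0 i)%:MP).
  by move=> _ ->; rewrite mevalB mevalXU mevalC subrr.
by rewrite mevalB mevalXU mevalC => ->.
Qed.

(** The space is arbitrary here, so that the same lemma serves the empty set
    (with any v) and a singleton. *)
Lemma dim_lt_sub_point X (v : 'rV[K]_n) d :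
  X `<=` [set v] -> (0 < d)%N -> dim_lt X d.
Proof.
move=> /zariski_closureS; rewrite zariski_closure_point => clX d_gt0.
case=> Z [ZX Zlt].
have [[_ [[w Z0w] _] Z0X] [_ _ Z1X]] := (ZX 0%N (leq0n d), ZX 1%N d_gt0).
have [_] := Zlt 0%N d_gt0; apply=> u /Z1X/clX ->.
by have <- : w = v by exact/clX/Z0X.
Qed.

End ZariskiFacts.

(** * Sylvester determinants of formal degrees *)

Section Sylvester.
Variable A : comNzRingType.

Definition band (k d : nat) (P : {poly A}) : 'M[A]_(k, d) :=
  \matrix_(i, j) ('X^i * P)`_j.

(** The degrees m of P and n of Q are formal, and not read off from the actual
    sizes, so that the construction commutes with specializations that make
    leading coefficients vanish ([map_sylvester]). *)
Definition sylvester (m n : nat) (P Q : {poly A}) : 'M[A]_(n + m) :=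
  col_mx (band n (n + m) P) (band m (n + m) Q).

Lemma mul_row_band k d P (u : 'rV[A]_k) j :
  (u *m band k d P) ord0 j = (rVpoly u * P)`_j.
Proof.
rewrite mxE /rVpoly poly_def mulr_suml coef_sum; apply: eq_bigr => i _.
by rewrite mxE valK -scalerAl coefZ.
Qed.

Lemma mul_band_powers k d (P : {poly A}) (t : A) i : ((size P).-1 + k <= d)%N ->
  (band k d P *m \col_(j < d) t ^+ j) i ord0 = t ^+ i * P.[t].
Proof.
move=> szP; rewrite -hornerXn -hornerM (@horner_coef_wide _ d).
  by rewrite mxE; apply: eq_bigr => j _; rewrite !mxE.
apply: leq_trans (size_polyMleq _ _) _; rewrite size_polyXn /=.
apply: leq_trans szP; have := ltn_ord i.
case: (size P) => [|s] /= ik; first by rewrite addn0 add0n ltnW.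
by rewrite addnS -addSn addnC leq_add2l.
Qed.

Lemma sylvester_common_root m n (P Q : {poly A}) (t : A) :
  (size P <= m.+1)%N -> (size Q <= n.+1)%N ->
  P.[t] = 0 -> Q.[t] = 0 ->
  sylvester m n P Q *m \col_(j < n + m) t ^+ j = 0.
Proof.
move=> szP szQ Pt Qt; apply/colP => i; rewrite mul_col_mx mxE [RHS]mxE.
have leq_pred s k : (s <= k.+1 -> s.-1 <= k)%N by case: s.
case: splitP => k _; rewrite mul_band_powers ?Pt ?Qt ?mulr0 //.
  by rewrite [leqRHS]addnC leq_add2r leq_pred.
by rewrite leq_add2r leq_pred.
Qed.

End Sylvester.

Lemma map_sylvester (A B : comNzRingType) (f : {rmorphism A -> B}) m n P Q :
  map_mx f (sylvester m n P Q) = sylvester m n (map_poly f P) (map_poly f Q).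
Proof.
rewrite map_col_mx; congr col_mx; apply/matrixP => i j;
  by rewrite !mxE -coef_map rmorphM /= map_polyXn.
Qed.

Lemma det_sylvester_common_root (F : fieldType) m n (P Q : {poly F}) t :
  (0 < n + m)%N -> (size P <= m.+1)%N -> (size Q <= n.+1)%N ->
  root P t -> root Q t -> \det (sylvester m n P Q) = 0.
Proof.
move=> nm_gt0 szP szQ /rootP Pt /rootP Qt; apply/eqP; rewrite -det_tr.
apply/det0P; exists (\col_(j < n + m) t ^+ j)^T; last first.
  by rewrite -trmx_mul sylvester_common_root // trmx0.
apply/eqP => /matrixP /(_ ord0 (Ordinal nm_gt0)) /eqP.
by rewrite !mxE expr0 oner_eq0.
Qed.

(** P divides V * Q, hence V, whose degree is too small for V to be nonzero. *)
Lemma coprime_syzygy0 (F : fieldType) m (P Q U V : {poly F}) :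
  coprimep P Q -> P`_m != 0 -> (size V <= m)%N -> U * P + V * Q = 0 ->
  U = 0 /\ V = 0.
Proof.
move=> coPQ Pm szV /eqP; rewrite addrC addr_eq0 => /eqP VQ.
have szP : (m < size P)%N by apply: contraNT Pm; rewrite -leqNgt => /leq_sizeP->.
have P_neq0 : P != 0 by apply: contraNneq Pm => ->; rewrite coef0.
have V0 : V = 0.
  apply: contraTeq szV => V_neq0; rewrite -ltnNge (leq_trans szP) //.
  rewrite dvdp_leq // -(Gauss_dvdpl _ coPQ) VQ.
  by rewrite dvdpNr dvdp_mulIr.
split=> //; apply/eqP; move/esym/eqP: VQ; rewrite V0 mul0r oppr_eq0 mulf_eq0.
by rewrite (negPf P_neq0) orbF.
Qed.

(** A row in the kernel of the Sylvester matrix is a relation U P + V Q = 0 with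
    deg U < n and deg V < m.  If P, Q are coprime, such a relation is trivial
    as soon as one of them attains its formal degree.  The case where neither
    does is a common root at infinity. *)
Lemma det_sylvester_eq0 (F : fieldType) m n (P Q : {poly F}) :
  (size P <= m.+1)%N -> (size Q <= n.+1)%N -> \det (sylvester m n P Q) = 0 ->
  (P`_m = 0 /\ Q`_n = 0) \/ ~~ coprimep P Q.
Proof.
move=> szP szQ /eqP /det0P [u u_neq0 uS].
case: (boolP (coprimep P Q)) => coPQ; last by right.
left; apply/and_comm.
set U := rVpoly (lsubmx u); set V := rVpoly (rsubmx u).
have szU : (size U <= n)%N by apply: size_poly.
have szV : (size V <= m)%N by apply: size_poly.
have UV : U * P + V * Q = 0.
  apply/polyP => j; rewrite coef0.
  have [j_lt|j_ge] := ltnP j (n + m).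
    rewrite -(hsubmxK u) mul_row_col in uS.
    move/matrixP/(_ ord0 (Ordinal j_lt)): uS.
    by rewrite mxE !mul_row_band mxE -coefD.
  apply: (leq_sizeP _ (n + m)%N _ j j_ge).
  apply: leq_trans (size_polyD _ _) _; rewrite geq_max.
  apply/andP; split; apply: leq_trans (size_polyMleq _ _) _.
    by rewrite -subn1 leq_subLR add1n -addnS leq_add.
  by rewrite -subn1 leq_subLR add1n [(n + m)%N]addnC -addnS leq_add.
have UV_neq0 : ~ (U = 0 /\ V = 0).
  case=> U0 V0; case/eqP: u_neq0.
  rewrite -(hsubmxK u) -(rVpolyK (lsubmx u)) -(rVpolyK (rsubmx u)).
  by rewrite -/U -/V U0 V0 !linear0 row_mx0.
split; apply/eqP; apply: contra_notT UV_neq0.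
  move=> Qn; apply/and_comm; apply: (@coprime_syzygy0 _ _ Q P _ _ _ Qn szU).
    by rewrite coprimep_sym.
  by rewrite addrC.
by move=> Pm; apply: (coprime_syzygy0 coPQ Pm szV).
Qed.

(** * Rational functions as pencils of polynomials *)

Section Pencil.
Variable F : fieldType.
Implicit Types (a b : {poly F}) (w t : F).

(** For coprime a and b, the degree of a / b as a self-map of the projective
    line. *)
Definition ratdeg a b := (maxn (size a) (size b)).-1.

(** The roots of this polynomial are the parameters t where a / b takes the
    value w; a drop of its degree below [ratdeg a b] means that a / b takes the
    value w at infinity. *)
Definition pencil a b w := a - w *: b.

Lemma size_pencil a b w : (size (pencil a b w) <= (ratdeg a b).+1)%N.
Proof.
rewrite (leq_trans _ (leqSpred _)) // (leq_trans (size_polyD _ _)) //.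
rewrite size_polyN geq_max leq_maxl (leq_trans (size_scale_leq _ _)) //.
exact: leq_maxr.
Qed.

(** The value of a / b at infinity is unique: the coefficients of a and b in
    degree [ratdeg a b] are not both zero. *)
Lemma pencil_lead_inj a b w w' : b != 0 ->
  (pencil a b w)`_(ratdeg a b) = 0 -> (pencil a b w')`_(ratdeg a b) = 0 ->
  w = w'.
Proof.
move=> b_neq0; rewrite !coefB !coefZ => /eqP; rewrite subr_eq0 => /eqP aw /eqP.
rewrite subr_eq0 => /eqP aw'.
have [bm0|bm] := eqVneq b`_(ratdeg a b) 0; last by apply: (mulIf bm); rewrite -aw.
have am0 : a`_(ratdeg a b) = 0 by rewrite aw bm0 mulr0.
case/eqP: b_neq0; move: am0 bm0; rewrite /ratdeg.
case: (leqP (size a) (size b)) => [ab _ /eqP|ba /eqP].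
  by rewrite -lead_coefE lead_coef_eq0 => /eqP.
rewrite -lead_coefE lead_coef_eq0 => /eqP a0.
by rewrite a0 size_poly0 in ba.
Qed.

End Pencil.

(** A reduced representative is what makes [ratval] an algebraic condition: see
    [ratval_pencil]. *)
Lemma fraction_coprime (F : fieldType) (f : {fraction {poly F}}) :
  exists a b, [/\ b != 0, coprimep a b & f = tofrac a / tofrac b].
Proof.
have [a [b [b_neq0 ->]]] : exists a b, b != 0 /\ f = tofrac a / tofrac b.
  elim/quotW: f => x; exists (frac x).1, (frac x).2.
  split; first exact: denom_ratioP.
  apply: (mulIf (x := tofrac (frac x).2)); first by rewrite tofrac_eq0 denom_ratioP.
  rewrite mulfVK ?tofrac_eq0 ?denom_ratioP //; unlock tofrac.
  rewrite -[LHS]FracField.pi_mul; apply/eqmodP; rewrite /= FracField.equivfE.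
  rewrite /FracField.mulf !numden_Ratio ?oner_eq0 ?mulf_neq0 ?denom_ratioP ?oner_eq0 //.
  by rewrite !mulr1 mulrC.
have g_neq0 : gcdp a b != 0 by rewrite gcdp_eq0 negb_and b_neq0 orbT.
have db : gcdp a b %| b := dvdp_gcdr a b; have da := dvdp_gcdl a b.
exists (a %/ gcdp a b), (b %/ gcdp a b); split.
- by rewrite dvdp_div_eq0.
- by rewrite coprimep_div_gcd // b_neq0 orbT.
apply/eqP; rewrite GRing.eqr_div ?tofrac_eq0 ?dvdp_div_eq0 //.
rewrite -!tofracM tofrac_eq; apply/eqP.
by rewrite -{1}(divpK da) mulrAC -mulrA divpK.
Qed.

Lemma point3E (A : Type) (v : 'rV[A]_3) :
  v = point3 (v ord0 0) (v ord0 1) (v ord0 2).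
Proof.
by apply/rowP => -[[|[|[|]]] //= lt3]; rewrite mxE /=; congr (v _ _); apply: val_inj.
Qed.

Lemma point3_inj (A : Type) (x y z x' y' z' : A) :
  point3 x y z = point3 x' y' z' -> [/\ x = x', y = y' & z = z'].
Proof.
move/matrixP => e.
by have := e ord0 0; have := e ord0 1; have := e ord0 2; rewrite !mxE /= => -> -> ->.
Qed.

(** * A rational profile curve misses at most one point *)

Section GenericPencil.
Variables (K : fieldType) (n : nat).

(** [pencil a b] with its value w replaced by an indeterminate, so that the
    Sylvester determinant of two of them is a polynomial on the space. *)
Definition generic_pencil (i : 'I_n) (a b : {poly K}) : {poly {mpoly K[n]}} :=
  map_poly (mpolyC n (R := K)) a - 'X_i *: map_poly (mpolyC n (R := K)) b.

Lemma meval_generic_pencil i a b (v : 'I_n -> K) :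
  map_poly (meval v) (generic_pencil i a b) = pencil a b (v i).
Proof.
have mK (c : {poly K}) : map_poly (meval v) (map_poly (mpolyC n (R := K)) c) = c.
  by rewrite -map_poly_comp map_poly_id // => x _ /=; rewrite mevalC.
by rewrite /generic_pencil rmorphB /= map_polyZ /= !mK mevalXU.
Qed.

Lemma meval_det_sylvester i j m k a b c d (v : 'I_n -> K) :
  (\det (sylvester m k (generic_pencil i a b) (generic_pencil j c d))).@[v] =
  \det (sylvester m k (pencil a b (v i)) (pencil c d (v j))).
Proof. by rewrite -det_map_mx map_sylvester !meval_generic_pencil. Qed.

End GenericPencil.

Section Curves.
Variable R : realType.
Local Notation C := R[i].
Local Notation Rt := {fraction {poly R}}.
Local Notation cpoly := (map_poly (real_complex R)).
Implicit Types (p q f : Rt) (a b : {poly R}) (t w x y z : C) (v : 'rV[C]_3).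

(** Coprimality excludes a root of b: it would also be a root of a. *)
Lemma ratval_pencil a b t w : b != 0 -> coprimep a b ->
  ratval (tofrac a / tofrac b) t w <-> root (pencil (cpoly a) (cpoly b) w) t.
Proof.
move=> b_neq0 co_ab; rewrite /root /pencil hornerD hornerN hornerZ subr_eq0.
split=> [[a' [b' [/eqP e b't ->]]]|/eqP at_].
  have b'_neq0 : b' != 0 by apply: contraNneq b't => ->; rewrite rmorph0 horner0.
  move: e; rewrite GRing.eqr_div ?tofrac_eq0 // -!tofracM tofrac_eq => /eqP e.
  apply/eqP; apply: (mulIf b't); rewrite mulrAC mulfVK //.
  by rewrite -!hornerM -!rmorphM /= e.
have bt : (cpoly b).[t] != 0.
  apply/eqP => bt0; have := co_ab; rewrite -(coprimep_map (real_complex R)).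
  by move/coprimep_root => /(_ t); rewrite /root at_ bt0 mulr0 eqxx => /(_ isT)/eqP.
by exists a, b; split=> //; rewrite at_ mulfK.
Qed.

Lemma ratval0 t w : ratval (0 : Rt) t w <-> w = 0.
Proof.
have -> : (0 : Rt) = tofrac (0 : {poly R}) / tofrac 1 by rewrite tofrac0 mul0r.
rewrite ratval_pencil ?oner_eq0 ?coprimep1 //.
rewrite /pencil rmorph0 rmorph1 sub0r /root hornerN hornerZ hornerE mulr1 oppr_eq0.
by split=> /eqP.
Qed.

Lemma ratvalN f t w : ratval f t w -> ratval (- f) t (- w).
Proof.
case=> a [b [-> bt ->]]; exists (- a), b; split=> //.
  by rewrite rmorphN mulNr.
by rewrite rmorphN hornerN mulNr.
Qed.

Lemma curve_reach_profile p q v :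
  curve_reach (profile p q) v <->
  exists t y z, [/\ ratval p t y, ratval q t z & v = point3 0 y z].
Proof.
split=> [[t rv]|[t [y [z [py qz ->]]]]].
  exists t, (v ord0 1), (v ord0 2); split.
  - by have := rv 1; rewrite mxE.
  - by have := rv 2; rewrite mxE.
  rewrite [LHS]point3E; congr point3.
  by have := rv 0; rewrite mxE /= => /ratval0.
exists t => -[[|[|[|]]] //= lt3]; rewrite !mxE //=.
exact/ratval0.
Qed.

Lemma curve_profile_x0 p q v : curve (profile p q) v -> v ord0 0 = 0.
Proof.
move=> /(_ 'X_0); rewrite mevalXU; apply=> w /curve_reach_profile.
by case=> t [y [z [_ _ ->]]]; rewrite mevalXU mxE.
Qed.

Lemma curve_profileE p q v :
  curve (profile p q) v -> v = point3 0 (v ord0 1) (v ord0 2).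
Proof. by move=> cv; rewrite [LHS]point3E (curve_profile_x0 cv). Qed.

(** At a reached point the parameter is a common root of the two pencils, and
    the resultant, being a polynomial, also vanishes on the closure. *)
Lemma curve_resultant0 a b c d v (p := tofrac a / tofrac b : Rt)
    (q := tofrac c / tofrac d : Rt)
    (m := ratdeg (cpoly a) (cpoly b)) (n := ratdeg (cpoly c) (cpoly d)) :
  b != 0 -> d != 0 -> coprimep a b -> coprimep c d -> (0 < n + m)%N ->
  curve (profile p q) v ->
  \det (sylvester m n (pencil (cpoly a) (cpoly b) (v ord0 1))
                      (pencil (cpoly c) (cpoly d) (v ord0 2))) = 0.
Proof.
move=> b_neq0 d_neq0 co_ab co_cd nm_gt0 cv.
rewrite -meval_det_sylvester; apply: cv => w.
case/curve_reach_profile => t [y [z [py qz ->]]]; rewrite meval_det_sylvester !mxE /=.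
apply: (@det_sylvester_common_root _ _ _ _ _ t) => //.
- exact: size_pencil.
- exact: size_pencil.
- exact/ratval_pencil.
- exact/ratval_pencil.
Qed.

(** A point of the curve that no parameter reaches is the value at infinity. *)
Lemma missed_pencil_lead a b c d v (p := tofrac a / tofrac b : Rt)
    (q := tofrac c / tofrac d : Rt)
    (m := ratdeg (cpoly a) (cpoly b)) (n := ratdeg (cpoly c) (cpoly d)) :
  b != 0 -> d != 0 -> coprimep a b -> coprimep c d -> (0 < n + m)%N ->
  critical_point (profile p q) v ->
  (pencil (cpoly a) (cpoly b) (v ord0 1))`_m = 0 /\
  (pencil (cpoly c) (cpoly d) (v ord0 2))`_n = 0.
Proof.
move=> b_neq0 d_neq0 co_ab co_cd nm_gt0 [cv missed].
have := curve_resultant0 b_neq0 d_neq0 co_ab co_cd nm_gt0 cv.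
case/det_sylvester_eq0 => //; try exact: size_pencil.
move/Pdiv.ClosedField.coprimepP => noncoprime.
case: missed; apply/curve_reach_profile.
apply: contrapT => nreach; apply: noncoprime => t rt; apply/negP => rt'.
apply: nreach; exists t, (v ord0 1), (v ord0 2); split.
- exact/ratval_pencil.
- exact/ratval_pencil.
- exact: curve_profileE cv.
Qed.

Lemma ratdeg_gt0 a b : b != 0 -> coprimep a b ->
  (forall c : R, tofrac a / tofrac b != tofrac c%:P :> Rt) ->
  (0 < ratdeg (cpoly a) (cpoly b))%N.
Proof.
move=> b_neq0 co_ab nonconst; rewrite /ratdeg !size_map_poly.
rewrite lt0n; apply/eqP => deg0.
have : (maxn (size a) (size b) <= 1)%N by rewrite (leq_trans (leqSpred _)) // deg0.
rewrite geq_max => /andP[/size1_polyC ea /size1_polyC eb].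
have b0 : b`_0 != 0 by move: b_neq0; rewrite eb polyC_eq0 coefC.
have /eqP[] := nonconst (a`_0 / b`_0).
apply: (mulIf (x := tofrac b)); first by rewrite tofrac_eq0.
by rewrite mulfVK ?tofrac_eq0 // -tofracM {2}eb -polyCM mulfVK // -ea.
Qed.

(** Both points are the value at infinity.  That q is nonconstant makes the
    Sylvester matrix nonempty, without which its determinant would be 1. *)
Lemma critical_point_unique p q v v' :
  (forall c : R, q != tofrac c%:P) ->
  critical_point (profile p q) v -> critical_point (profile p q) v' -> v = v'.
Proof.
have [a [b [b_neq0 co_ab ->]]] := fraction_coprime p.
have [c [d [d_neq0 co_cd ->]]] := fraction_coprime q.
move=> /(ratdeg_gt0 d_neq0 co_cd) n_gt0 crit crit'.
have nm_gt0 m : (0 < ratdeg (cpoly c) (cpoly d) + m)%N by rewrite addn_gt0 n_gt0.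
have [Py Qz] := missed_pencil_lead b_neq0 d_neq0 co_ab co_cd (nm_gt0 _) crit.
have [Py' Qz'] := missed_pencil_lead b_neq0 d_neq0 co_ab co_cd (nm_gt0 _) crit'.
rewrite (curve_profileE crit.1) (curve_profileE crit'.1).
congr point3.
  by apply: pencil_lead_inj Py Py'; rewrite map_poly_eq0.
by apply: pencil_lead_inj Qz Qz'; rewrite map_poly_eq0.
Qed.

End Curves.

(** * Rotating the profile plane *)

Section Rotation.
Variable K : fieldType.
Implicit Types (x y z r : K) (f A B : {mpoly K[3]}).

(** A and B are the parts of f(0, r, z) that are even in r and, after division by
    r, odd in r, with r^2 replaced by x^2 + y^2.  They are functions of the
    rotated point alone, which is how a polynomial on the profile plane gives
    polynomials on the surface. *)
Lemma rotation_split f : exists A B, forall x y z r,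
  r ^+ 2 = x ^+ 2 + y ^+ 2 ->
  f.@[point3 0 r z ord0] =
    A.@[point3 x y z ord0] + r * B.@[point3 x y z ord0].
Proof.
pose split g := exists A B, forall x y z r, r ^+ 2 = x ^+ 2 + y ^+ 2 ->
  g.@[point3 0 r z ord0] =
    A.@[point3 x y z ord0] + r * B.@[point3 x y z ord0].
have splitC c : split c%:MP.
  by exists c%:MP, 0 => *; rewrite meval0 !mevalC mulr0 addr0.
have splitD g h : split g -> split h -> split (g + h).
  move=> [A [B gAB]] [A' [B' hAB]]; exists (A + A'), (B + B') => x y z r e.
  by rewrite !mevalD (gAB _ _ _ _ e) (hAB _ _ _ _ e); ring.
have splitM g h : split g -> split h -> split (g * h).
  move=> [A [B gAB]] [A' [B' hAB]].
  (* (A + r B) (A' + r B') with r^2 = x^2 + y^2 *)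
  exists (A * A' + ('X_0 ^+ 2 + 'X_1 ^+ 2) * (B * B')), (A * B' + B * A').
  move=> x y z r e; rewrite mevalM (gAB _ _ _ _ e) (hAB _ _ _ _ e).
  rewrite !(mevalD, mevalM, expr2, mevalXU) !mxE /= -!expr2 -e; ring.
have splitX i : split 'X_i.
  case: i => -[|[|[|]]] // lt3.
  - by exists 0, 0 => *; rewrite mevalXU !meval0 mxE /= mulr0 addr0.
  - by exists 0, 1 => *; rewrite mevalXU meval0 meval1 mxE /= mulr1 add0r.
  - exists ('X_(Ordinal lt3)), 0 => *.
    by rewrite !mevalXU meval0 !mxE /= mulr0 addr0.
elim/mpolyind: f => [|c m g _ _ splitg]; first by rewrite -mpolyC0; exact: (splitC).
apply: splitD splitg; rewrite -mul_mpolyC; apply: (splitM); first exact: splitC.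
rewrite mpolyXE_id; apply: big_ind => [||i _]; [exact: (splitC 1)|exact: splitM|].
elim: (m i) => [|k splitXk]; first exact: (splitC 1).
by rewrite exprS; apply: splitM.
Qed.

(** The inverse of the parametrization of the circle is the stereographic
    projection from (0, -r), that is s = x / (r + y). *)
Lemma circle_param x y r : 2 != 0 :> K -> x ^+ 2 + y ^+ 2 = r ^+ 2 ->
  r != 0 -> r + y != 0 ->
  exists s, [/\ 1 + s ^+ 2 != 0, 2 * s / (1 + s ^+ 2) * r = x &
                (1 - s ^+ 2) / (1 + s ^+ 2) * r = y].
Proof.
move=> two_neq0 e r_neq0 ry_neq0; exists (x / (r + y)).
have d : 1 + (x / (r + y)) ^+ 2 = 2 * r / (r + y).
  have -> : 1 + (x / (r + y)) ^+ 2 =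
      (r ^+ 2 + 2 * r * y + (x ^+ 2 + y ^+ 2)) / (r + y) ^+ 2.
    by field.
  by rewrite e; field.
have d' : 1 - (x / (r + y)) ^+ 2 = 2 * y / (r + y).
  have -> : 1 - (x / (r + y)) ^+ 2 =
      (r ^+ 2 + 2 * r * y + 2 * y ^+ 2 - (x ^+ 2 + y ^+ 2)) / (r + y) ^+ 2.
    by field.
  by rewrite e; field.
rewrite d d'; split; last by field; rewrite r_neq0 ry_neq0.
  by rewrite !mulf_neq0 ?invr_neq0.
by field; rewrite r_neq0 ry_neq0.
Qed.

End Rotation.

(** * Missed points of the surface *)

Section Surface.
Variable R : realType.
Local Notation C := R[i].
Local Notation Rt := {fraction {poly R}}.
Implicit Types (p q : Rt) (x y z r s t : C) (v : 'rV[C]_3).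

(** By symmetry the mirror image of a reached point lies on the profile curve. *)
Lemma vanishing_mirror p q f t y z : symmetric_profile p q ->
  vanishing (curve_reach (profile p q)) f -> ratval p t y -> ratval q t z ->
  f.@[point3 0 (- y) z ord0] = 0.
Proof.
move=> sym f0 py qz.
suff : curve (profile p q) (point3 0 (- y) z) by apply.
rewrite sym; apply/sub_zariski_closure/curve_reach_profile.
by exists t, (- y), z; split=> //; apply: ratvalN.
Qed.

(** Let f vanish on the profile curve and write f(0, r, z) = A + r B.  By
    symmetry A - r B vanishes as well on reached points, so A and r B do, and so
    do the polynomials A and r^2 B^2 = (x^2 + y^2) B^2 on the surface.  Thus
    A = r B = 0 at any point of the surface, and f(0, r, z) = 0 for both signs
    of r. *)
Lemma surface_slice p q x y z r : symmetric_profile p q ->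
  r ^+ 2 = x ^+ 2 + y ^+ 2 -> surface p q (point3 x y z) ->
  curve (profile p q) (point3 0 r z).
Proof.
move=> sym er Sxyz f f0.
have [A [B fAB]] := rotation_split f.
have AB0 v : surface_reach p q v ->
    A.@[v ord0] = 0 /\ (('X_0 ^+ 2 + 'X_1 ^+ 2) * B ^+ 2).@[v ord0] = 0.
  case=> s [t [s_ok [y' [z' [py qz ->]]]]].
  set X := _ * y'; set Y := _ * y'.
  have e : y' ^+ 2 = X ^+ 2 + Y ^+ 2 by rewrite /X /Y; field.
  have : A.@[point3 X Y z' ord0] + y' * B.@[point3 X Y z' ord0] = 0.
    rewrite -(fAB _ _ _ _ e); apply: f0; apply/curve_reach_profile.
    by exists t, y', z'.
  have : A.@[point3 X Y z' ord0] + (- y') * B.@[point3 X Y z' ord0] = 0.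
    rewrite -(fAB X Y z' (- y')) ?sqrrN //.
    exact: vanishing_mirror sym f0 py qz.
  rewrite !(mevalD, mevalM, expr2, mevalXU) !mxE /= -!expr2 -e.
  set a := A.@[_]; set b := B.@[_] => eN eP.
  have a0 : a = 0.
    have /eqP : 2 * a = (a + y' * b) + (a + (- y') * b) by ring.
    by rewrite eP eN addr0 mulf_eq0 pnatr_eq0 => /eqP.
  by split=> //; rewrite a0 add0r in eP; rewrite -exprMn eP expr0n.
have A0 : A.@[point3 x y z ord0] = 0 by apply: Sxyz => v /AB0[].
have : (('X_0 ^+ 2 + 'X_1 ^+ 2) * B ^+ 2).@[point3 x y z ord0] = 0.
  by apply: Sxyz => v /AB0[].
rewrite (fAB _ _ _ _ er) A0 add0r.
rewrite !(mevalD, mevalM, expr2, mevalXU) !mxE /= -!expr2 -er -exprMn.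
by move/eqP; rewrite expf_eq0 => /eqP.
Qed.

Lemma curve_sub_surface p q : curve (profile p q) `<=` surface p q.
Proof.
apply: zariski_closureS => _ /curve_reach_profile [t [y [z [py qz ->]]]].
exists 0, t; rewrite /surface_val expr0n addr0 subr0 oner_neq0; split=> //.
by exists y, z; split=> //; rewrite mulr0 !mul0r divr1 mul1r.
Qed.

Lemma surface_reach_circle p q x y z r :
  r ^+ 2 = x ^+ 2 + y ^+ 2 -> r != 0 -> r + y != 0 ->
  curve_reach (profile p q) (point3 0 r z) -> surface_reach p q (point3 x y z).
Proof.
move=> er r_neq0 ry_neq0 /curve_reach_profile [t [r' [z' [pr qz e]]]].
have [_ rr' zz'] := point3_inj e; rewrite -{}rr' in pr; rewrite -{}zz' in qz.
have two_neq0 : 2 != 0 :> C by rewrite pnatr_eq0.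
have [s [s_ok ex ey]] := circle_param two_neq0 (esym er) r_neq0 ry_neq0.
by exists s, t; split=> //; exists r, z; split; rewrite ?ex ?ey.
Qed.

(** The hypothesis on x and y excludes the points with x^2 + y^2 = 0 and x <> 0;
    there the circle degenerates to a pair of isotropic lines, and rotating the
    profile point (0, 0, z) does not reach them. *)
Lemma missed_surface_point p q x y z :
  (forall c : R, q != tofrac c%:P) -> symmetric_profile p q ->
  x = 0 \/ x ^+ 2 + y ^+ 2 != 0 ->
  surface p q (point3 x y z) -> ~ surface_reach p q (point3 x y z) ->
  critical_point (profile p q) (point3 x y z).
Proof.
move=> q_nonconst sym xy Sv missed.
have [x0|x_neq0] := eqVneq x 0.
  rewrite x0 in Sv missed *.
  have y2 : y ^+ 2 = 0 ^+ 2 + y ^+ 2 by rewrite expr0n add0r.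
  split; first exact: surface_slice Sv.
  case/curve_reach_profile => t [y' [z' [py qz e]]].
  have [_ yy' zz'] := point3_inj e.
  apply: missed; exists 0, t; rewrite /surface_val expr0n addr0 subr0 oner_neq0.
  split=> //; exists y', z'; split=> //.
  by rewrite mulr0 !mul0r divr1 mul1r yy' zz'.
have xy_neq0 : x ^+ 2 + y ^+ 2 != 0.
  by case: xy => // x0; rewrite x0 eqxx in x_neq0.
(* Reaching (0, r, z) would reach (x, y, z): r + y <> 0, since otherwise
   x^2 = r^2 - y^2 = 0. *)
have critical r : r ^+ 2 = x ^+ 2 + y ^+ 2 ->
    critical_point (profile p q) (point3 0 r z).
  move=> er; split; first exact: surface_slice Sv.
  have r_neq0 : r != 0 by apply: contraNneq xy_neq0 => r0; rewrite -er r0 expr0n.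
  have ry_neq0 : r + y != 0.
    apply: contraNneq x_neq0 => /eqP; rewrite addr_eq0 => /eqP ry.
    rewrite ry sqrrN in er; rewrite -sqrf_eq0.
    by apply/eqP/(addIr (y ^+ 2)); rewrite add0r.
  by move/(surface_reach_circle er r_neq0 ry_neq0).
have er := sqrtCK (x ^+ 2 + y ^+ 2); set r := sqrtC _ in er.
have erN : (- r) ^+ 2 = x ^+ 2 + y ^+ 2 by rewrite sqrrN.
have e := critical_point_unique q_nonconst (critical _ er) (critical _ erN).
have [_ /eqP + _] := point3_inj e; rewrite -subr_eq0 opprK -mulr2n mulrn_eq0 /=.
by move=> /eqP r0; rewrite -er r0 expr0n eqxx in xy_neq0.
Qed.

Lemma real_point_anisotropic v : real_points R v ->
  v ord0 0 = 0 \/ v ord0 0 ^+ 2 + v ord0 1 ^+ 2 != 0.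
Proof.
case=> u _ <-; rewrite !mxE.
have [->|u0] := eqVneq (u ord0 0) 0; [by left|right].
rewrite -!rmorphXn -rmorphD fmorph_eq0 paddr_eq0 ?sqr_ge0 //.
by rewrite sqrf_eq0 (negPf u0).
Qed.

Lemma missed_real_point p q v :
  (forall c : R, q != tofrac c%:P) -> symmetric_profile p q ->
  surface p q v -> real_points R v -> ~ surface_reach p q v ->
  critical_point (profile p q) v.
Proof.
move=> q_nonconst sym Sv /real_point_anisotropic xy missed.
by rewrite (point3E v) in Sv missed *; apply: missed_surface_point.
Qed.

End Surface.

Theorem theorem2p1 (R : realType) (p q : {fraction {poly R}})
    (p_neq0 : p != 0)
    (q_nonconst : forall c : R, q != tofrac c%:P)
    (rP_proper : proper_param (profile p q))
    (CP_symmetric : symmetric_profile p q) :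
  (normal_param (profile p q) ->
     real_critical_set p q set0 /\
     surface p q `&` real_points R `<=` surface_reach p q) /\
  (~ normal_param (profile p q) ->
     forall b c : R[i], critical_point (profile p q) (point3 0 b c) ->
       real_critical_set p q [set point3 0 b c]).
Proof.
split=> [normal|_ b c crit].
  have reach : surface p q `&` real_points R `<=` surface_reach p q.
    move=> v [Sv real_v]; apply: contrapT.
    move=> /(missed_real_point q_nonconst CP_symmetric Sv real_v) [cv].
    by apply; apply: normal.
  split=> //; split=> //.
  - exact: (@dim_lt_sub_point _ _ _ 0).
  - by move=> v [/reach].
split.
- by move=> _ ->; apply: curve_sub_surface crit.1.
- exact: (@dim_lt_sub_point _ _ _ (point3 0 b c)).
- move=> v [[Sv real_v] missed]; apply: critical_point_unique crit => //.
  exact: missed_real_point.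
Qed.
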